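(* Let $\mathcal I$ be a flat ideal of subsets of $\omega$. Then either $\mathcal I\equiv_T[\mathfrak c]^{<\omega}$ or $\mathcal I$ is gradually flat.
   Context: A submeasure is a map $\varphi\colon\mathcal P(\omega)\to[0,\infty]$ with $\varphi(\emptyset)=0$, monotone and subadditive; it is lower semicontinuous (lsc) if $\varphi(a)=\lim_n\varphi(a\cap[0,n])$. $\mathrm{Fin}(\varphi)=\{a:\varphi(a)<\infty\}$. An lsc submeasure $\varphi$ is flat if for each $M>0$ there is $N>0$ such that for each finite $a\subseteq\omega$ with $\varphi(a)<N$ there is $j$ such that for all $b\subseteq\omega\setminus j$, $\varphi(b)<M$ implies $\varphi(a\cup b)<N$. It is gradual if for each $M>0$ there is $N>0$ such that for each $l$ there is $j$ such that for every family $B$ of at most $l$ subsets of $\omega\setminus j$, $\max_{b\in B}\varphi(b)<M$ implies $\varphi(\bigcup B)<N$. An ideal is flat (resp. gradually flat) if it equals $\mathrm{Fin}(\varphi)$ for some flat (resp. flat and gradual) lsc submeasure $\varphi$. Ideals are ordered by inclusion; $[\mathfrak c]^{<\omega}$ is the set of finite subsets of $2^\omega$ ordered by inclusion. $P\le_T Q$ means there is a map $P\to Q$ sending unbounded sets to unbounded sets, and $P\equiv_T Q$ means $P\le_T Q$ and $Q\le_T P$. *)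

(* Defs.v *)
From mathcomp Require Import all_boot all_order all_algebra.
From mathcomp Require Import all_classical all_reals all_analysis.
Set Implicit Arguments.
Unset Strict Implicit.
Unset Printing Implicit Defensive.
Import Order.TTheory GRing.Theory Num.Theory.
Import numFieldNormedType.Exports.
Local Open Scope classical_set_scope.
Local Open Scope ring_scope.
Local Open Scope ereal_scope.

Section Submeasures.
Variable R : realType.
Implicit Types phi : set nat -> \bar R.

Definition submeasure phi : Prop :=
  [/\ forall a, 0 <= phi a,
      phi set0 = 0,
      forall a b, a `<=` b -> phi a <= phi b &
      forall a b, phi (a `|` b) <= phi a + phi b].

(* `I_n.+1 is the closed initial segment [0, n]. *)
Definition lsc phi : Prop :=
  forall a, phi (a `&` `I_n.+1) @[n --> \oo] --> phi a.

Definition lsc_submeasure phi : Prop := submeasure phi /\ lsc phi.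

Definition Fin_ideal phi : set (set nat) := [set a | phi a < +oo].

(* ~` `I_j is the complement of the ordinal j = {0, ..., j - 1}. *)
Definition flat phi : Prop :=
  forall M : R, (0 < M)%R -> exists N : R, (0 < N)%R /\
    forall a : set nat, finite_set a -> phi a < N%:E ->
      exists j : nat, forall b : set nat, b `<=` ~` `I_j ->
        phi b < M%:E -> phi (a `|` b) < N%:E.

(* B #<= `I_l says that B has at most l elements. *)
Definition gradual phi : Prop :=
  forall M : R, (0 < M)%R -> exists N : R, (0 < N)%R /\
    forall l : nat, exists j : nat, forall B : set (set nat),
      (B #<= `I_l)%card -> (forall b, B b -> b `<=` ~` `I_j) ->
      (forall b, B b -> phi b < M%:E) -> phi (\bigcup_(b in B) b) < N%:E.

Definition flat_ideal (I : set (set nat)) : Prop :=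
  exists phi, [/\ lsc_submeasure phi, flat phi & I = Fin_ideal phi].

Definition gradually_flat_ideal (I : set (set nat)) : Prop :=
  exists phi, [/\ lsc_submeasure phi, flat phi, gradual phi &
                  I = Fin_ideal phi].

End Submeasures.

(* Neither properness nor the inclusion of all finite sets is required. *)
Definition ideal_on_omega (I : set (set nat)) : Prop :=
  [/\ I set0,
      forall a b, a `<=` b -> I b -> I a &
      forall a b, I a -> I b -> I (a `|` b)].

Definition unbounded (P : Type) (leP : P -> P -> Prop) (X : set P) : Prop :=
  ~ exists p, forall x, X x -> leP x p.

Definition tukey_le (P Q : Type) (leP : P -> P -> Prop)
    (leQ : Q -> Q -> Prop) : Prop :=
  exists f : P -> Q,
    forall X : set P, unbounded leP X -> unbounded leQ (f @` X).

Definition tukey_equiv (P Q : Type) (leP : P -> P -> Prop)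
    (leQ : Q -> Q -> Prop) : Prop :=
  tukey_le leP leQ /\ tukey_le leQ leP.

(* A family of sets F, coerced to the type of its members, under inclusion. *)
Definition inclusion_order (T : Type) (F : set (set T)) : F -> F -> Prop :=
  fun a b => \val a `<=` \val b.
Arguments inclusion_order {T} F.

Definition fin_continuum : set (set (nat -> bool)) := [set a | finite_set a].

(* Main.v *)
Require Import Defs.
From mathcomp Require Import finmap.
From mathcomp Require Import all_boot all_order all_algebra.
From mathcomp Require Import all_classical all_reals all_analysis.
Set Implicit Arguments.
Unset Strict Implicit.
Unset Printing Implicit Defensive.
Import Order.TTheory GRing.Theory Num.Theory.
Local Open Scope classical_set_scope.
Local Open Scope ring_scope.
Local Open Scope ereal_scope.

(** Suppose that [phi] is flat but not gradual.  Non-graduality yields [M] and,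
    for each [n], a bound [l n] such that arbitrarily far out there are blocks
    of weight [n]: at most [l n] finite sets, each of submeasure less than [M],
    whose union has submeasure greater than [n].  Flatness lets us place
    countably many blocks so sparsely that every transversal, i.e. every union
    of one member from each block, has submeasure at most the [N] that flatness
    assigns to [M].  Use one block of weight [n] for each [n] and each finite
    list of words of a common length.  An infinite word picks from this block
    the member whose index is the position in the list of its own prefix of
    that length; its picks form a transversal.  Among infinitely many infinite
    words, [l n] have distinct prefixes of some common length; for the list of
    these prefixes they pick up the whole block of weight [n].  Hence the
    transversals of infinitely many words never have a common upper bound in
    [Fin phi], and taking binary words reduces the finite subsets of the
    continuum to [Fin phi].  The converse reduction holds for every ideal: it is
    directed and embeds into the continuum. *)

Lemma near_finite_set (I : choiceType) (T : Type) (F : set_system T)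
    (A : set I) (P : I -> T -> Prop) : Filter F -> finite_set A ->
  (forall i, A i -> \forall t \near F, P i t) ->
  \forall t \near F, forall i, A i -> P i t.
Proof. by move=> FF /finite_fsetP[X ->]; exact: filter_bigI. Qed.

Lemma finite_set_subsets (T : choiceType) (E : set T) :
  finite_set E -> finite_set [set a | a `<=` E].
Proof.
move=> Efin.
have : finite_set [set [set` X] | X in [set` fpowerset (fset_set E)]].
  exact/finite_image/finite_fset.
apply: sub_finite_set => a aE; have afin := sub_finite_set aE Efin.
exists (fset_set a); last by rewrite fset_setK.
by rewrite /= fpowersetE -fset_set_sub.
Qed.

Definition finite_sets (T : Type) : set (set T) := [set A | finite_set A].

Section TukeyReductions.
Variables (P : Type) (leP : P -> P -> Prop).

Definition directed : Prop :=
  forall X : set P, finite_set X -> exists p, forall x, X x -> leP x p.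

Lemma tukey_le_bounded (Q : Type) (leQ : Q -> Q -> Prop) (f : P -> Q) :
  (forall q, exists p, forall x, leQ (f x) q -> leP x p) -> tukey_le leP leQ.
Proof.
move=> fP; exists f => X Xunb [q fXq]; apply: Xunb.
have [p hp] := fP q; exists p => x Xx.
by apply/hp/fXq; exists x.
Qed.

Lemma directed_tukey_le_finite_sets (T : Type) (h : P -> T) :
  injective h -> directed -> tukey_le leP (inclusion_order (@finite_sets T)).
Proof.
move=> hinj dirP.
pose f p : @finite_sets T := SigSub (mem_set (finite_set1 (h p))).
apply: (@tukey_le_bounded _ _ f) => F.
have [|p hp] := dirP (h @^-1` \val F).
  by apply: finite_preimage (set_valP F) => ? ? _ _; exact: hinj.
by exists p => x xF; apply: hp; exact: xF.
Qed.

End TukeyReductions.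

Lemma finite_sets_tukey_le_directed (T P : Type) (leP : P -> P -> Prop)
    (x : T -> P) :
    (forall p q r, leP p q -> leP q r -> leP p r) -> directed leP ->
    (forall p, finite_set [set t | leP (x t) p]) ->
  tukey_le (inclusion_order (@finite_sets T)) leP.
Proof.
move=> trP dirP xfin.
have /choice[b xb] (F : @finite_sets T) :
    exists p, forall t, (\val F : set T) t -> leP (x t) p.
  have [p hp] := dirP _ (finite_image x (set_valP F)).
  by exists p => t Ft; apply: hp; exists t.
apply: (@tukey_le_bounded _ _ _ _ b) => p.
exists (SigSub (mem_set (xfin p))) => F bFp t Ft.
exact: trP (xb _ _ Ft) bFp.
Qed.

Lemma ideal_directed (I : set (set nat)) :
  ideal_on_omega I -> directed (inclusion_order I).
Proof.
move=> [I0 _ IU] X Xfin.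
have IX : I (\bigcup_(a in X) \val a).
  by apply: (fin_bigcup_closedP I).1 Xfin _ => // a _; exact: set_valP.
by exists (SigSub (mem_set IX)) => a Xa n an; exists a.
Qed.

Lemma ideal_tukey_le_continuum (I : set (set nat)) : ideal_on_omega I ->
  tukey_le (inclusion_order I) (inclusion_order fin_continuum).
Proof.
move=> /ideal_directed.
apply: (@directed_tukey_le_finite_sets _ _ _
  (fun (a : I) n => `[< (\val a : set nat) n >])).
move=> a b /funeqP ab; apply/val_inj/predeqP => n.
exact: asbool_eq_equiv (ab n).
Qed.

Lemma finite_sets_tukey_le_ideal (T : Type) (I : set (set nat))
    (x : T -> set nat) :
    ideal_on_omega I -> (forall t, I (x t)) ->
    (forall A, infinite_set A -> ~ I (\bigcup_(t in A) x t)) ->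
  tukey_le (inclusion_order (@finite_sets T)) (inclusion_order I).
Proof.
move=> hI Ix xinf; have [_ Isub _] := hI.
apply: (finite_sets_tukey_le_directed (x := fun t => SigSub (mem_set (Ix t)))).
- by move=> a b c; exact: subset_trans.
- exact: ideal_directed.
- move=> p; apply: contrapT => /xinf; apply; apply: Isub (set_valP p).
  exact: bigcup_sub.
Qed.

Lemma submeasure0 (R : realType) (phi : set nat -> \bar R) :
  submeasure phi -> phi set0 = 0.
Proof. by case. Qed.

Lemma submeasure_le (R : realType) (phi : set nat -> \bar R) (a b : set nat) :
  submeasure phi -> a `<=` b -> phi a <= phi b.
Proof. by case=> _ _ + _; exact. Qed.

Section Submeasure.
Variables (R : realType) (phi : set nat -> \bar R).
Hypothesis hphi : lsc_submeasure phi.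

Lemma lsc_le (a : set nat) (y : \bar R) :
  (forall n, phi (a `&` `I_n) <= y) -> phi a <= y.
Proof. by move=> ay; apply: (cvge_to_le (hphi.2 a)); exact: nearW. Qed.

Lemma lsc_bigcup_le (b : nat -> set nat) (y : \bar R) :
  (forall n, phi (\bigcup_(k in `I_n) b k) <= y) -> phi (\bigcup_k b k) <= y.
Proof.
move=> partial_le; apply: lsc_le => m.
have : \forall n \near \oo, forall p, ((\bigcup_k b k) `&` `I_m) p ->
    (\bigcup_(k in `I_n) b k) p.
  apply: near_finite_set => [|p [[k _ bkp] _]].
    exact/finite_setIr/finite_II.
  by exists k.+1 => // n kn; exists k.
move=> [n _ /(_ n (leqnn n))] sub.
exact: le_trans (submeasure_le hphi.1 sub) (partial_le n).
Qed.

Definition absorbing (M N : R) : Prop :=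
  forall a, finite_set a -> phi a < N%:E ->
    exists j, forall b, b `<=` ~` `I_j -> phi b < M%:E ->
      phi (a `|` b) < N%:E.

Definition small_beyond (M : R) (j : nat) (a : set nat) : Prop :=
  [/\ finite_set a, a `<=` ~` `I_j & phi a < M%:E].

Lemma absorbing_uniform (M N : R) (E : set nat) :
    absorbing M N -> finite_set E ->
  exists j, forall a b, a `<=` E -> phi a < N%:E -> small_beyond M j b ->
    phi (a `|` b) < N%:E.
Proof.
move=> absMN Efin.
have : \forall j \near \oo, forall a, a `<=` E -> phi a < N%:E ->
    forall b, small_beyond M j b -> phi (a `|` b) < N%:E.
  apply: near_finite_set (finite_set_subsets Efin) _ => a aE.
  have [aN|aN] := pselect (phi a < N%:E); last exact: nearW.
  have [i hi] := absMN a (sub_finite_set aE Efin) aN.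
  exists i => // j /= ij _ b [_ bj bM]; apply: hi => // p /bj/=.
  by apply: contra_not => /leq_trans; exact.
by move=> [j _ /(_ j (leqnn j)) hj]; exists j => a b aE aN; exact: hj.
Qed.

Lemma absorbing_sparse_bigcup_le (M N : R) : (0 < N)%R -> absorbing M N ->
  exists J : set nat -> nat, forall E b : nat -> set nat,
    (forall k, finite_set (E k)) -> (forall k, E k `|` b k `<=` E k.+1) ->
    (forall k, small_beyond M (J (E k)) (b k)) ->
  phi (\bigcup_k b k) <= N%:E.
Proof.
move=> N0 absMN.
have /choice[J hJ] (E : set nat) : exists j, finite_set E ->
    forall a b, a `<=` E -> phi a < N%:E -> small_beyond M j b ->
      phi (a `|` b) < N%:E.
  have [Efin|] := pselect (finite_set E); last by exists 0%N.
  by have [j hj] := absorbing_uniform absMN Efin; exists j.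
exists J => E b Efin Eb bJ; apply: lsc_bigcup_le => n; apply: ltW.
suff [] : \bigcup_(k in `I_n) b k `<=` E n /\
    phi (\bigcup_(k in `I_n) b k) < N%:E by [].
elim: n => [|n [subE ltN]].
  by rewrite II0 bigcup_set0 (submeasure0 hphi.1) lte_fin; split.
rewrite IIS bigcup_setU bigcup_set1; split.
  by apply: subset_trans (Eb n); exact: setSU.
exact: (hJ (E n)).
Qed.

Lemma absorbing_bounded_transversals (M N : R)
    (Q : nat -> set (seq (set nat))) :
    (0 < M)%R -> (0 < N)%R -> absorbing M N ->
    (forall k j, exists2 s, Q k s & {in s, forall a, small_beyond M j a}) ->
  exists s : nat -> seq (set nat), (forall k, Q k (s k)) /\
    forall c : nat -> nat, phi (\bigcup_k nth set0 (s k) (c k)) <= N%:E.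
Proof.
move=> M0 N0 /(absorbing_sparse_bigcup_le N0)[J hJ] hQ.
have /choice[G hG] (kj : nat * nat) : exists s,
    Q kj.1 s /\ {in s, forall a, small_beyond M kj.2 a}.
  by have [s] := hQ kj.1 kj.2; exists s.
pose E := fix E k : set nat :=
  if k is i.+1 then E i `|` \bigcup_(a in [set` G (i, J (E i))]) a else set0.
pose s k := G (k, J (E k)).
have sP k : Q k (s k) /\ {in s k, forall a, small_beyond M (J (E k)) a}.
  exact: hG (k, J (E k)).
exists s; split=> [k|c]; first by have [] := sP k.
have pick k : nth set0 (s k) (c k) \in set0 :: s k.
  have [ck|ck] := ltnP (c k) (size (s k)).
    by rewrite in_cons mem_nth ?orbT.
  by rewrite nth_default ?mem_head.
apply: (hJ E) => [k|k|k].
- elim: k => [|k IHk]; first exact: finite_set0.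
  rewrite finite_setU; split=> //.
  apply: bigcup_finite; first exact: finite_seq.
  by move=> a /(sP k).2[].
- apply: setUS; move: (pick k); rewrite in_cons => /predU1P[->//|pk] p kp.
  by exists (nth set0 (s k) (c k)).
- move: (pick k); rewrite in_cons => /predU1P[->|/(sP k).2//].
  by split=> //; rewrite (submeasure0 hphi.1) lte_fin.
Qed.

Definition heavy (l n : nat) : set (seq (set nat)) :=
  [set s | (size s <= l)%N /\ n%:R%:E < phi (\bigcup_(a in [set` s]) a)].

Lemma nongradual_heavy_blocks : ~ gradual phi ->
  exists2 M : R, (0 < M)%R & forall n : nat, exists l : nat, forall j : nat,
    exists2 s, heavy l n s & {in s, forall a, small_beyond M j a}.
Proof.
move=> /existsNP[M /not_implyP[M0 /forallNP noN]]; exists M => // n.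
have /not_andP[|/existsNP[l /forallNP noj]] := noN n.+1%:R.
  by rewrite ltr0Sn.
exists l => j.
have /existsNP[B /not_implyP[Bl /not_implyP[Bj /not_implyP[BM /negP]]]] :=
  noj j.
rewrite -leNgt => nB.
have [m nBm] : exists m, n%:R%:E < phi ((\bigcup_(b in B) b) `&` `I_m).
  apply: contrapT => /forallNP small; move: nB; apply/negP; rewrite -ltNge.
  apply: (@le_lt_trans _ _ n%:R%:E); last by rewrite lte_fin ltr_nat.
  by apply: lsc_le => m; rewrite leNgt; apply/negP.
pose truncB := (setI ^~ `I_m) @` B.
have truncl : (truncB #<= `I_l)%card := card_le_trans (card_image_le _ _) Bl.
have truncfin : finite_set truncB by apply/finite_set_leP; exists l.
exists (fset_set truncB); first split.
- exact: geq_card_fset_set.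
- by rewrite fset_setK// bigcup_image -setI_bigcupl.
- move=> a; rewrite in_fset_set// => /set_mem[b Bb <-]; split.
  + exact/finite_setIr/finite_II.
  + exact: subset_trans (@subIsetl _ _ _) (Bj b Bb).
  + exact: le_lt_trans (submeasure_le hphi.1 (@subIsetl _ _ _)) (BM b Bb).
Qed.

End Submeasure.

Lemma near_mkseq_neq (T : Type) (f g : nat -> T) :
  f <> g -> \forall m \near \oo, mkseq f m <> mkseq g m.
Proof.
move=> fg; have /existsNP[p fgp] : ~ (f =1 g) by move/funext.
exists p.+1 => // m /= pm /(congr1 (nth (f 0%N) ^~ p)).
by rewrite !nth_mkseq.
Qed.

Lemma near_mkseq_inj (T : choiceType) (A : set (nat -> T)) : finite_set A ->
  \forall m \near \oo, {in A &, injective (fun f => mkseq f m)}.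
Proof.
move=> Afin.
have : \forall m \near \oo, forall fg, (A `*` A) fg ->
    mkseq fg.1 m = mkseq fg.2 m -> fg.1 = fg.2.
  apply: near_finite_set => [|[f g] _ /=]; first exact: finite_setX.
  have [->|/eqP/near_mkseq_neq] := eqVneq f g; first exact: nearW.
  by apply: filterS => m.
by apply: filterS => m inj f g /set_mem Af /set_mem Ag; exact: (inj (f, g)).
Qed.

Definition prefix_index (T : eqType) (m : nat) (s : seq (seq T))
  (f : nat -> T) : nat := index (mkseq f m) s.

Lemma infinite_set_prefix_index (T : choiceType) (A : set (nat -> T))
    (l : nat) : infinite_set A ->
  exists m s, `I_l `<=` prefix_index m s @` A.
Proof.
move=> Ainf; have [f0 _] := infinite_setN0 Ainf.
have [B BA lB] := infinite_set_fset l Ainf.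
have [m _ /(_ m (leqnn m)) inj] := near_mkseq_inj (finite_fset B).
exists m, [seq mkseq f m | f <- B] => i /= il.
have iB : (i < size B)%N by exact: leq_trans lB.
exists (nth f0 B i); first exact/BA/mem_nth.
rewrite /prefix_index -(nth_map f0 [::] (fun f => mkseq f m))//.
rewrite index_uniq ?size_map// map_inj_in_uniq ?fset_uniq//.
by move=> f g fB gB; apply: inj; exact: mem_set.
Qed.

Lemma nongradual_infinite_bigcup (T : countType) (R : realType)
    (phi : set nat -> \bar R) :
    lsc_submeasure phi -> flat phi -> ~ gradual phi ->
  exists x : (nat -> T) -> set nat, (forall f, phi (x f) < +oo) /\
    forall A, infinite_set A -> phi (\bigcup_(f in A) x f) = +oo.
Proof.
move=> hphi hflat /(nongradual_heavy_blocks hphi)[M M0 /choice[l hl]].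
have [N [N0 absMN]] := hflat M M0.
pose decode (k : nat) : nat * (nat * seq (seq T)) :=
  odflt (0, (0, [::]))%N (unpickle k).
pose weight k := (decode k).1.
pose selector k := prefix_index (decode k).2.1 (decode k).2.2.
have [s [heavy_s transversal_le]] := absorbing_bounded_transversals hphi
  (Q := fun k => heavy phi (l (weight k)) (weight k)) M0 N0 absMN
  (fun k => hl (weight k)).
exists (fun f => \bigcup_k nth set0 (s k) (selector k f)).
split=> [f|A Ainf]; first exact: le_lt_trans (transversal_le _) (ltry _).
apply/eqyP => y /ltW/archi_boundP; set n := Num.bound y => /ltW yn.
have [m [t all_selected]] := infinite_set_prefix_index (l n) Ainf.
have [k kE] : exists k, decode k = (n, (m, t)).
  by exists (pickle (n, (m, t))); rewrite /decode pickleK.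
have [] := heavy_s k; rewrite /weight kE /= => size_sk /ltW n_le.
apply: (@le_trans _ _ n%:R%:E); first by rewrite lee_fin.
apply: le_trans n_le _; apply: (submeasure_le hphi.1).
move=> p [_ /= /(nthP set0)[i ik <-] ip].
have [f Af fi] := all_selected i (leq_trans ik size_sk).
by exists f => //; exists k; rewrite // /selector kE /= fi.
Qed.

Theorem theorem4p2 (R : realType) (I : set (set nat))
  (hI : ideal_on_omega I) (hflat : flat_ideal R I) :
  tukey_equiv (inclusion_order I) (inclusion_order fin_continuum) \/ gradually_flat_ideal R I.
Proof.
have [phi [hphi phiflat IE]] := hflat.
have [hgrad|hgrad] := pselect (gradual phi); first by right; exists phi.
left; split; first exact: ideal_tukey_le_continuum.
have [x [xfin xinf]] := nongradual_infinite_bigcup bool hphi phiflat hgrad.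
apply: (finite_sets_tukey_le_ideal (x := x)) => // [f|A /xinf]; rewrite IE.
  exact: xfin.
by rewrite /Fin_ideal /= => ->; rewrite ltxx.
Qed.
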